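(* Let $A$ be a C$^*$-algebra (not necessarily unital) and let $a, b \in A^+$. Then the following are equivalent: (1) $a \perp_{\infty}^e b$; (2) $a \perp_{\infty}^a b$; (3) $ab = 0$.
   Context: $A_{sa}$ denotes the real normed space of self-adjoint elements of $A$ with the C$^*$-norm, ordered by the cone $A^+$ of positive elements; order intervals are taken in $A_{sa}$: $[c,d] = \{x \in A_{sa} : c \le x \le d\}$. For elements $x, y$ of a real normed linear space, $x \perp_{\infty} y$ means $\|x + k y\| = \max\{\|x\|, \|k y\|\}$ for all $k \in \mathbb{R}$. For subsets $B,C$, $B \perp_{\infty} C$ means $x \perp_\infty y$ for all $x \in B$, $y \in C$. For $a,b \in A^+$: $a \perp_{\infty}^a b$ (absolutely $\infty$-orthogonal) means $[0,a] \perp_\infty [0,b]$; $a \perp_{\infty}^e b$ (extensively $\infty$-orthogonal) means $[-a,a] \perp_\infty [-b,b]$. *)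

(* Defs.v *)
From HB Require Import structures.
From mathcomp Require Import all_boot all_order all_algebra.
From mathcomp Require Import complex.
From mathcomp Require Import all_classical all_reals all_analysis.
Set Implicit Arguments.
Unset Strict Implicit.
Unset Printing Implicit Defensive.
Import Order.TTheory GRing.Theory Num.Theory.
Import numFieldNormedType.Exports.
Local Open Scope classical_set_scope.
Local Open Scope complex_scope.
Local Open Scope ring_scope.

(* A complex Banach space with a (not necessarily unital) associative bilinear
   product and a conjugate-linear involution satisfying the C*-identity.  The
   MathComp ring hierarchy has no non-unital rings, hence the explicit product.
   The norm of a normed module over R[i] is R[i]-valued, with values in the
   non-negative reals of R[i]. *)
HB.mixin Record NormedModule_isCStarAlgebra (R : realType) A
    of CompleteNormedModule R[i] A := {
  cmul : A -> A -> A;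
  star : A -> A;
  cmulA : forall x y z : A, cmul x (cmul y z) = cmul (cmul x y) z;
  cmulDl : forall x y z : A, cmul (x + y) z = cmul x z + cmul y z;
  cmulDr : forall x y z : A, cmul x (y + z) = cmul x y + cmul x z;
  cmulZl : forall (k : R[i]) (x y : A), cmul (k *: x) y = k *: cmul x y;
  cmulZr : forall (k : R[i]) (x y : A), cmul x (k *: y) = k *: cmul x y;
  starK : forall x : A, star (star x) = x;
  starD : forall x y : A, star (x + y) = star x + star y;
  starZ : forall (k : R[i]) (x : A), star (k *: x) = Num.conj k *: star x;
  starM : forall x y : A, star (cmul x y) = cmul (star y) (star x);
  norm_cmul_le : forall x y : A, `|cmul x y| <= `|x| * `|y|;
  cstar_identity : forall x : A, `|cmul (star x) x| = `|x| ^+ 2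
}.

#[short(type="cstarAlgType")]
HB.structure Definition CStarAlgebra (R : realType) :=
  { A of NormedModule_isCStarAlgebra R A & CompleteNormedModule R[i] A }.

Notation "x ** y" := (cmul x y) (at level 40, left associativity) : ring_scope.

Section CStarOrder.
Context {R : realType} {A : cstarAlgType R}.
Implicit Types a b c d x y : A.

Definition selfadjoint x : Prop := star x = x.

Definition cpositive x : Prop := exists y, x = star y ** y.

Definition cle x y : Prop := cpositive (y - x).

Definition sa_interval c d : set A :=
  [set x | [/\ selfadjoint x, cle c x & cle x d]].

End CStarOrder.

(* The scalar ranges over the real elements of K, so for K = R[i] this is
   oo-orthogonality in the underlying real normed space, and in particular in
   its real subspace of self-adjoint elements.  The maximum is taken between
   two non-negative reals, on which the order of K is total. *)
Definition oo_orth {K : numFieldType} {V : normedModType K} (x y : V) : Prop :=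
  forall k : K, k \is Num.real -> `|x + k *: y| = Num.max `|x| `|k *: y|.

Definition oo_orth_set {K : numFieldType} {V : normedModType K}
    (B C : set V) : Prop :=
  forall x y, B x -> C y -> oo_orth x y.

Definition abs_oo_orth {R : realType} {A : cstarAlgType R} (a b : A) : Prop :=
  oo_orth_set (sa_interval 0 a) (sa_interval 0 b).

Definition ext_oo_orth {R : realType} {A : cstarAlgType R} (a b : A) : Prop :=
  oo_orth_set (sa_interval (- a) a) (sa_interval (- b) b).

(* Main.v *)
Require Import Defs.
From HB Require Import structures.
From mathcomp Require Import all_boot all_order all_algebra.
From mathcomp Require Import complex ring lra.
From mathcomp Require Import all_classical all_reals all_analysis.
Set Implicit Arguments.
Unset Strict Implicit.
Unset Printing Implicit Defensive.
Import Order.TTheory GRing.Theory Num.Theory.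
Import numFieldNormedType.Exports.
Local Open Scope classical_set_scope.
Local Open Scope complex_scope.
Local Open Scope ring_scope.

(** Work with the operators x |-> h x on A instead of an adjoined unit and
    spectra: call a self-adjoint h positive ([spos]) when |1 - t h| <= 1 for some
    t > 0, meaning |x - t h x| <= |x| for all x.  For this notion sums are
    immediate by convexity.  Square roots of positive elements come from the
    iteration r' = (s + r^2)/2 ([sqrt_exists]); it also yields sqrt(1 - k^2) for
    a self-adjoint contraction k, and the isometries sqrt(1 - k^2) +- i k then
    show that squares are positive ([compl_contractive_sq]).  The cone is proper
    ([spos_anti]), and an argument of Fukamiya and Kaplansky shows that every
    star u ** u is positive ([spos_starM]); so [spos] is the given cone
    ([cpositiveP]).

    If a b = 0 and -a <= x <= a, then (x + a) + (a - x) = 2 a; compressing this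
    by b gives two positive elements with sum 0, so both vanish and x b = 0.
    Doing it once more, x y = 0 whenever -b <= y <= b, and the norm of a sum of
    orthogonal self-adjoint elements is the maximum of their norms, as one sees
    on iterated squares ([rnormD_orth]).  Hence a b = 0 implies extensive
    orthogonality, which implies absolute orthogonality because the intervals
    shrink.

    Conversely let a and b be absolutely orthogonal.  The resolvent
    e = a / (eps + a) satisfies eps e <= a, |e| <= 1 and a - a e = eps e
    ([approx_unit_exists]), so orthogonality of eps e and b gives
    |e + t b| = |e| <= 1 for t = |e| / |b|.  Compressing e + t b <= 1 by
    k = sqrt a gives t k b k <= a - a e = eps e.  As eps tends to 0, t stays
    bounded below, so k b k <= 0, hence k b k = 0 and a b = 0
    ([mul0_of_abs_oo_orth]). *)

(** * Linear identities in a module *)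

(** Formal linear combinations.  Two of them agree in every module as soon as
    their coefficients agree at each atom, which turns an identity between
    vectors into identities between scalars that [ring] or [field] can solve. *)
Inductive lexp (K : Type) :=
  LAtom of nat | LZero | LAdd of lexp K & lexp K | LOpp of lexp K
| LScale of K & lexp K.
Arguments LAtom {K}. Arguments LZero {K}.

Section LinearIdentities.
Context {K : pzRingType} {V : lmodType K}.

Fixpoint leval (env : seq V) (e : lexp K) : V :=
  match e with
  | LAtom i => env`_i
  | LZero => 0
  | LAdd e1 e2 => leval env e1 + leval env e2
  | LOpp e1 => - leval env e1
  | LScale c e1 => c *: leval env e1
  end.

Fixpoint lcoef (i : nat) (e : lexp K) : K :=
  match e with
  | LAtom j => if eqn i j then 1 else 0
  | LZero => 0
  | LAdd e1 e2 => lcoef i e1 + lcoef i e2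
  | LOpp e1 => - lcoef i e1
  | LScale c e1 => c * lcoef i e1
  end.

Fixpoint lcoefs_eq (n : nat) (e1 e2 : lexp K) : Prop :=
  if n is m.+1 then lcoef m e1 = lcoef m e2 /\ lcoefs_eq m e1 e2 else True.

Lemma leval_sum env e : leval env e = \sum_(i < size env) lcoef i e *: env`_i.
Proof.
have eqnE' i j : eqn i j = (i == j) by [].
elim: e => [j||e1 IH1 e2 IH2|e IH|c e IH] /=; rewrite ?IH1 ?IH2 ?IH /=.
- case: (ltnP j (size env)) => [jn|nj].
    rewrite (bigD1 (Ordinal jn)) //= eqnE' eqxx scale1r big1 ?addr0 // => i.
    by rewrite -val_eqE /= eqnE' => /negPf ->; rewrite scale0r.
  rewrite nth_default // big1 // => i _; rewrite eqnE'.
  by rewrite (ltn_eqF (leq_trans (ltn_ord i) nj)) scale0r.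
- by rewrite big1 // => i _; rewrite scale0r.
- by rewrite -big_split; apply: eq_bigr => i _ /=; rewrite scalerDl.
- by rewrite -sumrN; apply: eq_bigr => i _ /=; rewrite scaleNr.
- by rewrite scaler_sumr; apply: eq_bigr => i _; rewrite scalerA.
Qed.

Lemma leval_eq env e1 e2 : lcoefs_eq (size env) e1 e2 ->
  leval env e1 = leval env e2.
Proof.
move=> h; rewrite !leval_sum; apply: eq_bigr => -[i /= ilt] _; congr (_ *: _).
move: ilt h; elim: (size env) => // n IH; rewrite ltnS leq_eqVlt.
by move=> /predU1P[-> []|/IH {}IH [_ /IH]].
Qed.

End LinearIdentities.

Ltac lmem v env :=
  lazymatch env with
  | nil => constr:(false)
  | ?w :: ?env' => lazymatch constr:((v, w)) with
      | (?t, ?t) => constr:(true) | _ => lmem v env' end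
  end.
Ltac lindex v env :=
  lazymatch env with
  | ?w :: ?env' => lazymatch constr:((v, w)) with
      | (?t, ?t) => constr:(0%N)
      | _ => let n := lindex v env' in constr:(n.+1) end
  end.
Ltac latoms e env :=
  lazymatch e with
  | 0%R => env
  | (?x + ?y)%R => let env' := latoms x env in latoms y env'
  | (- ?x)%R => latoms x env
  | (_ *: ?x)%R => latoms x env
  | _ => lazymatch lmem e env with
      | true => env | false => constr:(e :: env) end
  end.
Ltac lreify K e env :=
  lazymatch e with
  | 0%R => constr:(@LZero K)
  | (?x + ?y)%R => let a := lreify K x env in let b := lreify K y env in
      constr:(LAdd a b)
  | (- ?x)%R => let a := lreify K x env in constr:(LOpp a)
  | (?c *: ?x)%R => let a := lreify K x env in constr:(LScale c a)
  | _ => let i := lindex e env in constr:(@LAtom K i)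
  end.
(* Products and images under the involution are atoms up to syntactic equality,
   so the goal has to be expanded and reassociated beforehand. *)
Ltac linear_with K :=
  lazymatch goal with
  | |- @eq ?T ?l ?r =>
    let env0 := latoms l constr:(@nil T) in
    let env := latoms r env0 in
    let a := lreify K l env in
    let b := lreify K r env in
    change (@leval K _ env a = @leval K _ env b);
    apply: leval_eq;
    cbv [lcoefs_eq lcoef size eqn];
    repeat apply: conj; first [done | by ring | by field | idtac]
  end.

(** * The real-valued norm and completeness *)

Section RealNorm.
Context {R : realType} {A : cstarAlgType R}.
Implicit Types (x y z : A) (t : R).

Lemma cmul0l x : 0 ** x = 0.
Proof. by have := cmulZl 0 (0 : A) x; rewrite !scale0r. Qed.

Lemma cmul0r x : x ** 0 = 0.
Proof. by have := cmulZr 0 x (0 : A); rewrite !scale0r. Qed.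

Lemma cmulNl x y : (- x) ** y = - (x ** y).
Proof. by rewrite -scaleN1r cmulZl scaleN1r. Qed.

Lemma cmulNr x y : x ** (- y) = - (x ** y).
Proof. by rewrite -scaleN1r cmulZr scaleN1r. Qed.

Lemma cmulBl x y z : (x - y) ** z = x ** z - y ** z.
Proof. by rewrite cmulDl cmulNl. Qed.

Lemma starZr t x : star (t%:C *: x) = t%:C *: star x.
Proof. by rewrite starZ /Num.conj /= oppr0. Qed.

Lemma starZi x : star ('i *: x) = - ('i *: star x).
Proof.
rewrite starZ -scaleNr; congr (_ *: _).
by apply/eqP; rewrite eq_complex /= oppr0 !eqxx.
Qed.

Lemma star0 : star 0 = 0 :> A.
Proof. by have := starZr 0 (0 : A); rewrite !scale0r. Qed.

Lemma starN x : star (- x) = - star x.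
Proof. by apply/eqP; rewrite -addr_eq0 -starD addNr star0. Qed.

Lemma starB x y : star (x - y) = star x - star y.
Proof. by rewrite starD starN. Qed.

(** The norm of A takes values in R[i], whose order is only partial; its real
    part gives access to real arithmetic. *)
Definition rnorm x : R := complex.Re `|x|.

Lemma rnormE x : `|x| = (rnorm x)%:C.
Proof. by rewrite /rnorm RRe_real ?ger0_real. Qed.

Lemma rnorm_ge0 x : 0 <= rnorm x.
Proof. by rewrite -ler0c -rnormE. Qed.

Lemma rnorm_eq0 x : rnorm x = 0 -> x = 0.
Proof. by move=> h; apply/normr0_eq0; rewrite rnormE h. Qed.

Lemma rnorm0 : rnorm 0 = 0.
Proof. by rewrite /rnorm normr0. Qed.

Lemma rnorm_gt0 x : x <> 0 -> 0 < rnorm x.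
Proof.
by move=> nz; rewrite lt_def rnorm_ge0 andbT; apply/eqP => /rnorm_eq0.
Qed.

Lemma rnormD x y : rnorm (x + y) <= rnorm x + rnorm y.
Proof. by rewrite -lecR rmorphD /= -!rnormE ler_normD. Qed.

Lemma rnormN x : rnorm (- x) = rnorm x.
Proof. by rewrite /rnorm normrN. Qed.

Lemma rnormB x y : rnorm (x - y) <= rnorm x + rnorm y.
Proof. by rewrite -(rnormN y) rnormD. Qed.

Lemma rnormZ t x : rnorm (t%:C *: x) = `|t| * rnorm x.
Proof.
apply: complexI; rewrite rmorphM /= -!rnormE normrZ; congr (_ * _).
by rewrite normc_def /= expr0n addr0 sqrtr_sqr.
Qed.

Lemma rnormM x y : rnorm (x ** y) <= rnorm x * rnorm y.
Proof. by rewrite -lecR rmorphM /= -!rnormE norm_cmul_le. Qed.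

Lemma rnorm_starM x : rnorm (star x ** x) = rnorm x ^+ 2.
Proof. by apply: complexI; rewrite rmorphXn /= -!rnormE cstar_identity. Qed.

Lemma rnorm_star x : rnorm (star x) = rnorm x.
Proof.
suff le y : rnorm y <= rnorm (star y).
  by apply/eqP; rewrite eq_le le andbT -{2}(starK x) le.
have [->|/eqP/rnorm_gt0 y0] := eqVneq y 0; first by rewrite star0.
by rewrite -(ler_pM2r y0) -expr2 -rnorm_starM rnormM.
Qed.

Lemma starM_eq0 x : star x ** x = 0 -> x = 0.
Proof.
by move=> h; apply/rnorm_eq0/eqP; rewrite -sqrf_eq0 -rnorm_starM h rnorm0.
Qed.

Lemma rnorm_sa_sq x : selfadjoint x -> rnorm (x ** x) = rnorm x ^+ 2.
Proof. by move=> sx; rewrite -rnorm_starM sx. Qed.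

(** Left multiplication represents A isometrically: test on star y. *)
Lemma rnorm_le_mul (c : R) y : 0 <= c ->
  (forall x, rnorm (y ** x) <= c * rnorm x) -> rnorm y <= c.
Proof.
move=> c0 h.
have [->|/eqP/rnorm_gt0 y0] := eqVneq y 0; first by rewrite rnorm0.
have := h (star y).
by rewrite -{1}(starK y) rnorm_starM rnorm_star expr2 ler_pM2r.
Qed.

Lemma rnorm_le_eps x (c : R) : (forall e, 0 < e -> rnorm x <= c * e) -> x = 0.
Proof.
move=> h; apply: rnorm_eq0; apply/eqP; rewrite eq_le rnorm_ge0 andbT.
apply/ler_addgt0Pr => e e0; rewrite add0r.
have c1 : 0 < 1 + `|c| by rewrite ltr_pwDl.
apply: le_trans (h _ (divr_gt0 e0 c1)) _.
rewrite mulrCA ger_pMr // ler_pdivrMr // mul1r.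
by rewrite (le_trans (ler_norm c)) // lerDr.
Qed.

(** Completeness with a rate: the limit inherits the Cauchy bound. *)
Lemma complete_rate (u : nat -> A) (w : nat -> R) :
  (forall m n, (m <= n)%N -> rnorm (u n - u m) <= w m) ->
  (forall e, 0 < e -> exists m, w m < e) ->
  exists l, forall m, rnorm (u m - l) <= w m.
Proof.
move=> uw w0.
have ballE (x y : A) (e : R[i]) : 0 < e ->
    rnorm (x - y) < complex.Re e -> ball x e y.
  move=> e0 h; rewrite -ball_normE /= rnormE -(RRe_real (gtr0_real e0)).
  by rewrite ltcR.
have ballE' (x y : A) (e : R) : ball x e%:C y -> rnorm (x - y) < e.
  by rewrite -ball_normE /= rnormE ltcR.
have /cauchy_cvg cu : cauchy (u @ \oo).
  apply: cauchy_exP => e e0.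
  have e0' : 0 < complex.Re e by move: e0; rewrite ltcE => /andP[].
  have [m wm] := w0 _ e0'; exists (u m); exists m => // n /= mn.
  apply: ballE => //; apply: le_lt_trans wm.
  by rewrite -rnormN opprB uw.
exists (lim (u @ \oo)) => m; apply/ler_addgt0Pr => e e0.
have [N _ hN] : \forall n \near \oo, ball (lim (u @ \oo)) e%:C (u n).
  by apply: cu; apply: nbhsx_ballx; rewrite ltcR.
have := hN (maxn m N) (leq_maxr _ _) => /ballE'.
have := uw _ _ (leq_maxl m N).
set l := lim _; set v := u (maxn m N) => h1 h2.
have -> : u m - l = - (v - u m) - (l - v) by linear_with R[i].
apply: le_trans (rnormB _ _) _; rewrite rnormN; lra.
Qed.

End RealNorm.

(** * Square roots by iteration *)

Definition cmulE {R : realType} {A : cstarAlgType R} :=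
  (@cmulDl R A, @cmulDr R A, @cmulNl R A, @cmulNr R A, @cmulZl R A,
   @cmulZr R A, @cmul0l R A, @cmul0r R A).

(** The iteration r' = (s + r^2)/2 solves (1 - r)^2 = 1 - s.  This is its scalar
    run for s = 1: its increments, which add up to 1, majorize in norm those of
    every run with a contraction s. *)
Fixpoint sqrt_rate {R : realType} (n : nat) : R :=
  if n is m.+1 then (1 + sqrt_rate m ^+ 2) / 2 else 0.

Section SqrtRate.
Context {R : realType}.
Local Notation rho := (@sqrt_rate R).

Lemma sqrt_rate_itv n : 0 <= rho n <= 1.
Proof. by elim: n => [|n /andP[h0 h1]] /=; [lra | nra]. Qed.

Lemma sqrt_rateS n : rho n <= rho n.+1.
Proof. by have /= := sqrt_rate_itv n; nra. Qed.

(** The defect d = 1 - sqrt_rate n satisfies d' = d - d^2/2, which is the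
    recursion behind a decay like 2/n. *)
Lemma sqrt_rate_lim n : 1 - rho n <= 2 / n.+2%:R.
Proof.
elim: n => [|n IH] /=; first lra.
have /andP[r0 r1] := sqrt_rate_itv n.
set u := 2 / n.+2%:R in IH *.
have u1 : u <= 1 by rewrite ler_pdivrMr ?ltr0n // mul1r ler_nat.
apply: (@le_trans _ _ (u - u ^+ 2 / 2)); first nra.
rewrite ler_pdivlMr ?ltr0n //.
have -> : n.+3%:R = n.+2%:R + 1 :> R by rewrite -natr1.
have : u * n.+2%:R = 2 by rewrite divfK // pnatr_eq0.
have : 0 <= u by rewrite divr_ge0.
nra.
Qed.

Lemma sqrt_rate_eps e : 0 < e -> exists n, 1 - rho n < e.
Proof.
move=> e0.
have [n _ hn] := near_infty_natSinv_lt (PosNum (divr_gt0 e0 (ltr0n R 2))).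
exists n; apply: le_lt_trans (sqrt_rate_lim n) _.
have /= := hn n (leqnn n); rewrite ltr_pdivlMr // mulrC; apply: le_lt_trans.
by rewrite ler_pM2l // lef_pV2 ?posrE ?ltr0n // ler_nat.
Qed.

End SqrtRate.

Section SquareRoots.
Context {R : realType} {A : cstarAlgType R}.
Implicit Types (b : bool) (h k x y z : A) (t : R).

(** The run of the iteration for the operator s = b - h (b = 0 or 1, h acting by
    left multiplication).  Its n-th term is b * sqrt_rate n - k_n for some k_n in
    the algebra, and [sqrt_iter] is this k_n: the unit stays in the scalar part,
    and [sqrt_op] is the whole operator. *)
Fixpoint sqrt_iter (b : bool) (h : A) (n : nat) : A :=
  if n is m.+1 then
    (2^-1)%:C *: (h + (2 * (b%:R * sqrt_rate m))%:C *: sqrt_iter b h m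
                  - sqrt_iter b h m ** sqrt_iter b h m)
  else 0.

Definition sqrt_op b h n x :=
  (b%:R * sqrt_rate n)%:C *: x - sqrt_iter b h n ** x.

Lemma sqrt_op0 b h x : sqrt_op b h 0 x = 0.
Proof. by rewrite /sqrt_op /= mulr0 scale0r cmul0l subr0. Qed.

Lemma sqrt_opS b h n x : sqrt_op b h n.+1 x =
  (2^-1)%:C *: ((b%:R%:C *: x - h ** x) + sqrt_op b h n (sqrt_op b h n x)).
Proof. by case: b; rewrite /sqrt_op /= !cmulE ?cmulA; linear_with R[i]. Qed.

Lemma sqrt_opB b h n x y :
  sqrt_op b h n (x - y) = sqrt_op b h n x - sqrt_op b h n y.
Proof. by rewrite /sqrt_op !cmulE; linear_with R[i]. Qed.

Lemma sqrt_iter_comm b h n y : h ** y = y ** h ->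
  sqrt_iter b h n ** y = y ** sqrt_iter b h n.
Proof.
move=> hy; elim: n => [|n IH] /=; first by rewrite cmul0l cmul0r.
rewrite !cmulE hy IH; congr (_ *: (_ - _)).
by rewrite -cmulA IH !cmulA IH.
Qed.

Lemma sqrt_iter_sa b h n : selfadjoint h -> selfadjoint (sqrt_iter b h n).
Proof.
rewrite /selfadjoint => sh; elim: n => [|n IH] /=; first by rewrite star0.
by rewrite starZr starB starD starZr starM sh IH.
Qed.

Lemma sqrt_op_norm b h n x :
  (forall y, rnorm (b%:R%:C *: y - h ** y) <= rnorm y) ->
  rnorm (sqrt_op b h n x) <= sqrt_rate n * rnorm x.
Proof.
move=> hN; elim: n x => [|n IH] x; first by rewrite sqrt_op0 rnorm0 mul0r.
rewrite sqrt_opS rnormZ ger0_norm ?invr_ge0 //=.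
have /andP[r0 r1] := @sqrt_rate_itv R n.
have := rnormD (b%:R%:C *: x - h ** x) (sqrt_op b h n (sqrt_op b h n x)).
have := hN x; have := IH (sqrt_op b h n x).
have : sqrt_rate n * rnorm (sqrt_op b h n x) <=
    sqrt_rate n * (sqrt_rate n * rnorm x) by rewrite ler_wpM2l.
nra.
Qed.

(** The majorization passes from one step to the next by
    v^2 - u^2 = (v - u) v + u (v - u), on the operator side and on the scalar
    side alike. *)
Lemma sqrt_op_step b h n x :
  (forall y, rnorm (b%:R%:C *: y - h ** y) <= rnorm y) ->
  rnorm (sqrt_op b h n.+1 x - sqrt_op b h n x) <=
  (sqrt_rate n.+1 - sqrt_rate n) * rnorm x.
Proof.
move=> hN; have qn m y := sqrt_op_norm m y hN.
elim: n x => [|n IH] x.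
  by rewrite sqrt_op0 subr0 [sqrt_rate 0]/= subr0 qn.
have -> : sqrt_op b h n.+2 x - sqrt_op b h n.+1 x = (2^-1)%:C *:
    ((sqrt_op b h n.+1 (sqrt_op b h n.+1 x) -
      sqrt_op b h n (sqrt_op b h n.+1 x))
     + sqrt_op b h n (sqrt_op b h n.+1 x - sqrt_op b h n x)).
  rewrite (sqrt_opB b h n (sqrt_op b h n.+1 x)) (sqrt_opS b h n.+1).
  by rewrite [X in _ - X = _](sqrt_opS b h n); linear_with R[i].
set v := sqrt_op b h n.+1 x; set u := sqrt_op b h n x.
have half0 : (0 : R) <= 2^-1 by rewrite invr_ge0.
rewrite rnormZ (ger0_norm half0).
have /andP[r0 r1] := @sqrt_rate_itv R n.
have h1 := rnormD (sqrt_op b h n.+1 v - sqrt_op b h n v)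
                  (sqrt_op b h n (v - u)).
have h2 := IH v; have h3 := qn n.+1 x; have h4 := qn n (v - u).
have h5 := IH x; have h6 := @sqrt_rateS R n.
have h7 : (sqrt_rate n.+1 - sqrt_rate n) * rnorm v <=
    (sqrt_rate n.+1 - sqrt_rate n) * (sqrt_rate n.+1 * rnorm x).
  by rewrite ler_wpM2l ?subr_ge0.
have h8 : sqrt_rate n * rnorm (v - u) <=
    sqrt_rate n * ((sqrt_rate n.+1 - sqrt_rate n) * rnorm x).
  by rewrite ler_wpM2l.
have -> : sqrt_rate n.+2 - sqrt_rate n.+1 =
   2^-1 * (sqrt_rate n.+1 ^+ 2 - sqrt_rate n ^+ 2) :> R by rewrite /=; field.
rewrite -mulrA ler_wpM2l //; move: h1 h2 h4 h7 h8.
by set a := sqrt_rate n.+1; nra.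
Qed.

(** Both the scalar part and the operator move by at most the increment of
    [sqrt_rate], whence the factor 2. *)
Lemma sqrt_iter_cauchy b h m n :
  (forall y, rnorm (b%:R%:C *: y - h ** y) <= rnorm y) -> (m <= n)%N ->
  rnorm (sqrt_iter b h n - sqrt_iter b h m) <= 2 * (1 - sqrt_rate m).
Proof.
move=> hN mn.
apply: (@le_trans _ _ (2 * (sqrt_rate n - sqrt_rate m))); last first.
  by have /andP[_] := @sqrt_rate_itv R n; lra.
rewrite -(subnKC mn); elim: (n - m)%N => [|d IH].
  by rewrite addn0 !subrr rnorm0 mulr0.
rewrite addnS; set i := (m + d)%N in IH *.
have ik : rnorm (sqrt_iter b h i.+1 - sqrt_iter b h i) <=
    2 * (sqrt_rate i.+1 - sqrt_rate i).
  have ri := @sqrt_rateS R i.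
  apply: rnorm_le_mul => [|x]; first by rewrite mulr_ge0 // subr_ge0.
  rewrite (_ : _ ** x = (b%:R * (sqrt_rate i.+1 - sqrt_rate i))%:C *: x -
     (sqrt_op b h i.+1 x - sqrt_op b h i x)); last first.
    by rewrite /sqrt_op !cmulE; set a := sqrt_rate i.+1; linear_with R[i].
  apply: le_trans (rnormB _ _) _; rewrite rnormZ.
  rewrite -mulrA mulrDl mul1r lerD //; last exact: sqrt_op_step.
  rewrite ler_wpM2r ?rnorm_ge0 //.
  by rewrite ger0_norm; case: (b); rewrite ?mul1r ?mul0r ?subr_ge0.
have := rnormD (sqrt_iter b h i.+1 - sqrt_iter b h i)
               (sqrt_iter b h i - sqrt_iter b h m).
by rewrite addrA subrK; move: IH ik; set a := sqrt_rate i.+1; lra.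
Qed.

(** With s = b - h, the limit k makes b - k a solution r of (1 - r)^2 = 1 - s.
    For b = 1 this reads k^2 = h, a square root of h.  For b = 0 it reads
    (1 + k)^2 = 1 + h, so that 1 + k is a square root of 1 + h. *)
Lemma sqrt_exists b h : selfadjoint h ->
  (forall x, rnorm (b%:R%:C *: x - h ** x) <= rnorm x) ->
  exists k, [/\ selfadjoint k,
    forall y, h ** y = y ** h -> k ** y = y ** k,
    (2 * (1 - b%:R))%:C *: k + k ** k = h &
    forall x, rnorm (b%:R%:C *: x - k ** x) <= rnorm x].
Proof.
move=> sh hN.
have kd m n : (m <= n)%N -> _ := fun mn => @sqrt_iter_cauchy b h m n hN mn.
have [|k hk] := complete_rate kd.
  move=> e e0; have [m hm] := sqrt_rate_eps (divr_gt0 e0 (ltr0n R 2)).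
  by exists m; rewrite mulrC -ltr_pdivlMr.
have app e : 0 < e -> exists n, [/\ rnorm (sqrt_iter b h n - k) <= e,
    rnorm (sqrt_iter b h n.+1 - k) <= e & 1 - sqrt_rate n <= e].
  move=> e0; have [n hn] := sqrt_rate_eps (divr_gt0 e0 (ltr0n R 2)).
  have := hk n.+1; have := @sqrt_rateS R n.
  by exists n; have := hk n; split; lra.
exists k; split.
- apply/subr0_eq; apply: (@rnorm_le_eps _ _ _ 2) => e e0.
  have [n [hn _ _]] := app _ e0; set u := sqrt_iter b h n in hn *.
  have -> : star k - k = (u - k) - star (u - k).
    by rewrite starB sqrt_iter_sa // -/u; linear_with R[i].
  by apply: le_trans (rnormB _ _) _; rewrite rnorm_star; lra.
- move=> y hy; apply/subr0_eq.
  apply: (@rnorm_le_eps _ _ _ (2 * rnorm y)) => e e0.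
  have [n [hn _ _]] := app _ e0; set u := sqrt_iter b h n in hn *.
  have -> : k ** y - y ** k = y ** (u - k) - (u - k) ** y.
    by rewrite !cmulE (sqrt_iter_comm _ _ hy) -/u; linear_with R[i].
  apply: le_trans (rnormB _ _) _.
  have := rnormM y (u - k); have := rnormM (u - k) y.
  by have := rnorm_ge0 y; nra.
- apply/subr0_eq; apply: (@rnorm_le_eps _ _ _ (10 + 4 * rnorm k)) => e e0.
  have [n [hn hn' hr]] := app _ e0.
  have /andP[r0 r1] := @sqrt_rate_itv R n.
  set u := sqrt_iter b h n in hn; set v := sqrt_iter b h n.+1 in hn'.
  set w := (2 * b%:R * (1 - sqrt_rate n))%:C *: u.
  set p := (u - k) ** u; set q := k ** (u - k).
  (* The recursion expresses h through v and u, so only differences of these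
     from k remain. *)
  have -> : (2 * (1 - b%:R))%:C *: k + k ** k - h =
      - (2%:C *: (v - k)) + ((2 * b%:R)%:C *: (u - k) - (w + (p + q))).
    by rewrite /p /q /w /v /= -/u !cmulE; linear_with R[i].
  have h1 : rnorm p <= _ := rnormM (u - k) u.
  have h2 : rnorm q <= _ := rnormM k (u - k).
  have h3 := rnormD p q.
  have hu : rnorm u <= rnorm k + 2.
    by have := hk n; have := rnormD (u - k) k; rewrite subrK -/u; lra.
  have k0 := rnorm_ge0 k; have u0 := rnorm_ge0 u.
  have /andP[b0 b1] : 0 <= (b%:R : R) <= 1 by rewrite ler0n lern1; case: (b).
  have h4 : rnorm ((2 * b%:R)%:C *: (u - k)) <= 2 * e.
    by rewrite rnormZ ger0_norm; nra.
  have h5 : rnorm w <= 2 * (rnorm k + 2) * e.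
    have c0 : 0 <= 2 * (b%:R : R) * (1 - sqrt_rate n) <= 2 * e.
      by apply/andP; split; nra.
    case/andP: c0 => c0 c1; rewrite rnormZ (ger0_norm c0) [leRHS]mulrAC.
    exact: ler_pM.
  have h6 : rnorm (- (2%:C *: (v - k))) <= 2 * e.
    by rewrite rnormN rnormZ ger0_norm //; lra.
  apply: le_trans (rnormD _ _) _.
  have h7 := rnormB ((2 * b%:R)%:C *: (u - k)) (w + (p + q)).
  have h8 := rnormD w (p + q).
  have h9 : rnorm (u - k) * rnorm u <= e * (rnorm k + 2).
    by rewrite ler_pM ?rnorm_ge0.
  have h10 : rnorm k * rnorm (u - k) <= rnorm k * e by rewrite ler_wpM2l.
  lra.
- move=> x; apply/ler_addgt0Pr => e e0.
  have c0 : 0 < 2 * (1 + rnorm x) by rewrite mulr_gt0 // ltr_pwDl // rnorm_ge0.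
  have [n [hn _ hr]] := app _ (divr_gt0 e0 c0).
  have /andP[r0 r1] := @sqrt_rate_itv R n.
  have := sqrt_op_norm n x hN; set u := sqrt_iter b h n in hn *.
  set f := e / _ in hn hr *.
  have fe : f * (2 * (1 + rnorm x)) = e by rewrite divfK // gt_eqF.
  set w := (b%:R * (1 - sqrt_rate n))%:C *: x.
  have -> : b%:R%:C *: x - k ** x = sqrt_op b h n x + (w + (u - k) ** x).
    by rewrite /w /sqrt_op -/u !cmulE; linear_with R[i].
  have h1 := rnormD (sqrt_op b h n x) (w + (u - k) ** x).
  have h2 := rnormD w ((u - k) ** x).
  have h3 := rnormM (u - k) x.
  have h4 : rnorm w <= f * rnorm x.
    rewrite rnormZ ler_wpM2r ?rnorm_ge0 //.
    case: (b); last by rewrite mul0r normr0; lra.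
    by rewrite mul1r ger0_norm // subr_ge0.
  have x0 := rnorm_ge0 x.
  have h5 : rnorm (u - k) * rnorm x <= f * rnorm x by rewrite ler_wpM2r.
  have h6 : sqrt_rate n * rnorm x <= rnorm x by rewrite ler_piMl.
  by have f0 : 0 <= f; [apply/ltW/divr_gt0|nra].
Qed.

End SquareRoots.

(** * Positivity without spectra *)

Section Positivity.
Context {R : realType} {A : cstarAlgType R}.
Implicit Types (h k x y z u : A) (t : R).

Lemma selfadjointD x y : selfadjoint x -> selfadjoint y -> selfadjoint (x + y).
Proof. by rewrite /selfadjoint starD => -> ->. Qed.

Lemma selfadjointN x : selfadjoint x -> selfadjoint (- x).
Proof. by rewrite /selfadjoint starN => ->. Qed.

Lemma selfadjointZ t x : selfadjoint x -> selfadjoint (t%:C *: x).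
Proof. by rewrite /selfadjoint starZr => ->. Qed.

Lemma selfadjointM x y : selfadjoint x -> selfadjoint y ->
  x ** y = y ** x -> selfadjoint (x ** y).
Proof. by rewrite /selfadjoint starM => -> -> ->. Qed.

Lemma selfadjoint_sq x : selfadjoint x -> selfadjoint (x ** x).
Proof. by move=> sx; apply: selfadjointM. Qed.

Lemma selfadjoint_starM x : selfadjoint (star x ** x).
Proof. by rewrite /selfadjoint starM starK. Qed.

(** The operator norm bound |1 - h| <= 1, with 1 the identity operator of A. *)
Definition compl_contractive h := forall x, rnorm (x - h ** x) <= rnorm x.

Lemma compl_contractive_sqrt h : selfadjoint h -> compl_contractive h ->
  exists k, [/\ selfadjoint k, compl_contractive k, k ** k = h &
    forall y, h ** y = y ** h -> k ** y = y ** k].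
Proof.
move=> sh hN; have [|k [sk kc kk kN]] := @sqrt_exists _ _ true _ sh.
  by move=> x; rewrite rmorph1 scale1r.
exists k; split=> //; first by move=> x; have := kN x; rewrite rmorph1 scale1r.
by rewrite -[RHS]kk subrr mulr0 scale0r add0r.
Qed.

(** The equation 2 r - r^2 = h says that 1 - r is a square root of 1 - h. *)
Lemma one_sub_sqrt h : selfadjoint h -> rnorm h <= 1 ->
  exists r, [/\ selfadjoint r, 2%:C *: r - r ** r = h &
    forall y, h ** y = y ** h -> r ** y = y ** r].
Proof.
move=> sh h1.
have [|k [sk kc kk _]] := @sqrt_exists _ _ false _ (selfadjointN sh).
  move=> x; rewrite scale0r sub0r cmulNl opprK.
  by apply: le_trans (rnormM _ _) _; rewrite ler_piMl ?rnorm_ge0.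
exists (- k); split; first exact: selfadjointN.
  have -> : h = - (2%:C *: k + k ** k).
    by apply: oppr_inj; rewrite opprK -[LHS]kk /= subr0 mulr1.
  by rewrite !cmulE; linear_with R[i].
by move=> y hy; rewrite cmulNl cmulNr kc // cmulNl cmulNr hy.
Qed.

(** A substitute for 0 <= star y y <= star y y + star z z, before positivity of
    star y y is known: both V = y + i z and W = y - i z satisfy
    star V V = star W W = star y y + star z z, and y is their mean. *)
Lemma rnorm_sq_le_add_starM y z : star y ** z = star z ** y ->
  rnorm y ^+ 2 <= rnorm (star y ** y + star z ** z).
Proof.
move=> yz; set s := rnorm (_ + _).
have normV (c : R[i]) : (forall v : A, star (c *: v) = - (c *: star v)) ->
    c * c = -1 -> rnorm (y + c *: z) = Num.sqrt s.
  move=> cS cc; rewrite -[LHS]ger0_norm ?rnorm_ge0 // -sqrtr_sqr -rnorm_starM.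
  congr (Num.sqrt (rnorm _)).
  by rewrite starD cS !cmulE scalerA cc yz; linear_with R[i].
have := rnormD (y + 'i *: z) (y + (- 'i) *: z).
rewrite !normV; last 4 first.
- by move=> v; rewrite !scaleNr starN starZi.
- by rewrite mulrNN -expr2 sqr_i.
- exact: starZi.
- by rewrite -expr2 sqr_i.
rewrite (_ : _ + _ = 2%:C *: y); last by linear_with R[i].
rewrite rnormZ ger0_norm // => h.
rewrite -[leRHS]sqr_sqrtr ?rnorm_ge0 //.
rewrite ler_pXn2r ?nnegrE ?rnorm_ge0 ?sqrtr_ge0 //.
lra.
Qed.

(** Let g = sqrt(1 - k^2) = 1 - r.  As g^2 + k^2 = 1, the operator g is a
    contraction by the previous lemma applied to g x and k x, and then so is
    1 - k^2 = g^2. *)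
Lemma compl_contractive_sq k : selfadjoint k -> rnorm k <= 1 ->
  compl_contractive (k ** k).
Proof.
move=> sk k1.
have [|r [sr rr rc]] := one_sub_sqrt (selfadjoint_sq sk).
  by rewrite rnorm_sa_sq // expr_le1 ?rnorm_ge0.
have rk : r ** k = k ** r by apply: rc; rewrite cmulA.
pose g x := x - r ** x.
have gE x : rnorm (g x) <= rnorm x.
  have krE : star x ** k ** r ** x = star x ** r ** k ** x.
    by rewrite -(cmulA (star x) k r) -rk cmulA.
  have kkE : star x ** k ** k ** x =
      2%:C *: (star x ** r ** x) - star x ** r ** r ** x.
    by rewrite -(cmulA (star x) k k) -rr !cmulE !cmulA.
  rewrite -(@ler_pXn2r _ 2) ?nnegrE ?rnorm_ge0 //.
  have := @rnorm_sq_le_add_starM (g x) (k ** x).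
  rewrite {1 2 4 5}/g starB !starM sr sk !cmulE !cmulA krE kkE => /(_ erefl) h.
  apply: le_trans h _; rewrite -rnorm_starM.
  rewrite le_eqVlt; apply/orP; left; apply/eqP.
  by congr rnorm; linear_with R[i].
move=> x; rewrite (_ : _ - _ = g (g x)); last first.
  by rewrite /g -rr !cmulE -?cmulA; linear_with R[i].
exact: le_trans (gE _) (gE _).
Qed.

(** For self-adjoint h the bound with t says that the spectrum of h lies in
    [0, 2/t]; as t is arbitrary, only its nonnegativity matters. *)
Definition spos h := selfadjoint h /\
  exists2 t, 0 < t & compl_contractive (t%:C *: h).

Lemma spos_sa h : spos h -> selfadjoint h. Proof. by case. Qed.

Lemma sposZ t h : 0 < t -> spos h -> spos (t%:C *: h).
Proof.
move=> t0 [sh [s s0 hs]]; split; first exact: selfadjointZ.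
exists (s / t); first exact: divr_gt0.
by rewrite scalerA -rmorphM divfK // gt_eqF.
Qed.

(** Convexity: 1 - s t (h + k) / (s + t) is a convex combination of 1 - s h and
    1 - t k. *)
Lemma sposD h k : spos h -> spos k -> spos (h + k).
Proof.
move=> [sh [s s0 hs]] [sk [t t0 ht]]; split; first exact: selfadjointD.
have st : 0 < s + t by rewrite addr_gt0.
exists (s * t / (s + t)) => [|x]; first by rewrite divr_gt0 ?mulr_gt0.
rewrite (_ : x - _ = (t / (s + t))%:C *: (x - (s%:C *: h) ** x) +
                     (s / (s + t))%:C *: (x - (t%:C *: k) ** x)); last first.
  have stC : s%:C + t%:C != 0 :> R[i] by rewrite -rmorphD fmorph_eq0 gt_eqF.
  by rewrite !cmulE; linear_with R[i]; field; exact: stC.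
apply: le_trans (rnormD _ _) _; rewrite !rnormZ.
have a0 : 0 <= t / (s + t) by rewrite divr_ge0 ?(ltW st) ?(ltW t0).
have b0 : 0 <= s / (s + t) by rewrite divr_ge0 ?(ltW st) ?(ltW s0).
rewrite (ger0_norm a0) (ger0_norm b0).
have -> : rnorm x = t / (s + t) * rnorm x + s / (s + t) * rnorm x.
  by field; rewrite gt_eqF.
by apply: lerD; apply: ler_wpM2l.
Qed.

Lemma spos_sqrt h : spos h ->
  exists k, [/\ selfadjoint k, spos k, k ** k = h &
    forall y, h ** y = y ** h -> k ** y = y ** k].
Proof.
move=> [sh [t t0 ht]].
have [k [sk ck kk kc]] := compl_contractive_sqrt (selfadjointZ t sh) ht.
have s0 : 0 < Num.sqrt t by rewrite sqrtr_gt0.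
have ss : Num.sqrt t * Num.sqrt t = t by rewrite -expr2 sqr_sqrtr // ltW.
exists ((Num.sqrt t)^-1%:C *: k); split.
- exact: selfadjointZ.
- apply: sposZ; first by rewrite invr_gt0.
  by split=> //; exists 1; rewrite ?ltr01 // rmorph1 scale1r.
- rewrite !cmulE kk !scalerA -!rmorphM /= -invfM ss mulVf ?rmorph1 ?scale1r //.
  by rewrite gt_eqF.
- by move=> y hy; rewrite !cmulE kc // !cmulE hy.
Qed.

Lemma spos_sq k : selfadjoint k -> spos (k ** k).
Proof.
move=> sk; split; first exact: selfadjoint_sq.
have k0 : 0 < 1 + rnorm k by rewrite ltr_pwDl ?rnorm_ge0.
set s := (1 + rnorm k)^-1; have s0 : 0 < s by rewrite invr_gt0.
exists (s * s); first exact: mulr_gt0.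
have := @compl_contractive_sq _ (selfadjointZ s sk).
rewrite !cmulE scalerA -rmorphM; apply.
by rewrite rnormZ ger0_norm ?(ltW s0) // mulrC ler_pdivrMr // mul1r lerDr.
Qed.

(** Any scale up to 1 / |h| works in the definition of positivity: write h as a
    square. *)
Lemma spos_compl_contractive h : spos h -> rnorm h <= 1 -> compl_contractive h.
Proof.
move=> /spos_sqrt[k [sk _ <- _]] h1; apply: compl_contractive_sq => //.
by move: h1; rewrite rnorm_sa_sq // expr_le1 // rnorm_ge0.
Qed.

(** Otherwise some g of norm 1 satisfies |1 - g| <= 1 and |1 + g| <= 1, and then
    4 g = (1 + g)^2 - (1 - g)^2 has norm at most 2. *)
Lemma spos_anti h : spos h -> spos (- h) -> h = 0.
Proof.
move=> hp hn; apply: contrapT => /rnorm_gt0 h0.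
pose g := (rnorm h)^-1%:C *: h.
have n0 : 0 < (rnorm h)^-1 by rewrite invr_gt0.
have g1 : rnorm g = 1 by rewrite rnormZ ger0_norm ?(ltW n0) // mulVf // gt_eqF.
have cg : compl_contractive g.
  by apply: spos_compl_contractive; [exact: sposZ | rewrite g1].
have cg' : compl_contractive (- g).
  apply: spos_compl_contractive; last by rewrite rnormN g1.
  by rewrite -scalerN; exact: sposZ.
move: g => g in g1 cg cg' *.
have : rnorm g <= 2^-1.
  apply: rnorm_le_mul => [|x]; first by rewrite invr_ge0.
  have -> : g ** x = (4^-1)%:C *:
    (((x - (- g) ** x) - (- g) ** (x - (- g) ** x)) -
     ((x - g ** x) - g ** (x - g ** x))).
    by rewrite !cmulE; linear_with R[i].
  rewrite rnormZ ger0_norm ?invr_ge0 //.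
  have := le_trans (cg (x - g ** x)) (cg x).
  have := le_trans (cg' (x - (- g) ** x)) (cg' x).
  have := rnormB ((x - (- g) ** x) - (- g) ** (x - (- g) ** x))
    ((x - g ** x) - g ** (x - g ** x)).
  lra.
by rewrite g1; lra.
Qed.

End Positivity.

(** * The cone of the elements star u ** u *)

Section PositiveCone.
Context {R : realType} {A : cstarAlgType R}.
Implicit Types (a g h k w x y z u : A) (t : R).

(** If w = x + i y with x, y self-adjoint, this is 2 (x^2 + y^2). *)
Lemma spos_starM_add w : spos (star w ** w + w ** star w).
Proof.
have -> : star w ** w + w ** star w =
    (2^-1)%:C *: ((w + star w) ** (w + star w) +
                  ('i *: (w - star w)) ** ('i *: (w - star w))).
  rewrite (cmulZl 'i) (cmulZr 'i) scalerA -expr2 sqr_i !cmulE.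
  by linear_with R[i].
apply: sposZ; first by rewrite invr_gt0.
apply: sposD; apply: spos_sq; rewrite /selfadjoint.
  by rewrite starD starK addrC.
by rewrite starZi starB starK -scalerN opprB.
Qed.

(** Let h = star u u, let g = sqrt(h^2) be its absolute value and p = g - h,
    twice the negative part of h, so that h p = - p g.  For w = u p sqrt g one finds star w w = - (p g)^2 and
    w star w = - (u p star u)^2: both are negative, while their sum is positive.
    So p g = 0, whence p^2 = 2 p g = 0 and h = g. *)
Lemma spos_starM u : spos (star u ** u).
Proof.
set h := star u ** u; have sh : selfadjoint h := selfadjoint_starM u.
have [g [sg pg gg gc]] := spos_sqrt (spos_sq sh).
have gh : g ** h = h ** g by apply: gc; rewrite cmulA.
have [l [sl _ ll lc]] := spos_sqrt pg.
have lh : l ** h = h ** l by apply: lc.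
have lg : l ** g = g ** l by apply: lc.
pose p := g - h.
have pE : p = g - h by [].
have sp : selfadjoint p by rewrite /selfadjoint starB sg sh.
have lp : l ** p = p ** l by rewrite /p !cmulE lh lg.
have gp : g ** p = p ** g by rewrite /p !cmulE gh.
have hp : h ** p = - (p ** g).
  by rewrite /p !cmulE gg opprB.
have pp : p ** p = 2%:C *: (p ** g).
  by rewrite {1}/p cmulBl hp gp; linear_with R[i].
clearbody p.
pose w := u ** p ** l.
have ww : star w ** w = - ((p ** g) ** (p ** g)).
  rewrite !starM sl sp !cmulA -(cmulA _ (star u)) -/h.
  rewrite -(cmulA (l ** p) h p) hp !cmulE !cmulA; congr (- _).
  rewrite lp -(cmulA p l p) lp cmulA -(cmulA _ g l) -lg cmulA.
  by rewrite -(cmulA _ l l) ll -(cmulA p g p) gp cmulA.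
have ww' : w ** star w = - ((u ** p ** star u) ** (u ** p ** star u)).
  rewrite !starM sl sp !cmulA -(cmulA (u ** p) l l) ll.
  rewrite -(cmulA _ (star u) u) -/h -(cmulA _ h p) hp -(cmulA _ g p) gp.
  by rewrite !cmulE !cmulA opprK.
have spg : selfadjoint (p ** g) by exact: selfadjointM.
have pg0 : p ** g = 0.
  apply: starM_eq0; rewrite spg.
  apply: spos_anti; first exact: spos_sq.
  have -> : - (p ** g ** (p ** g)) = (star w ** w + w ** star w) +
      (u ** p ** star u) ** (u ** p ** star u).
    by rewrite ww ww' subrK.
  apply: sposD; first exact: spos_starM_add.
  by apply: spos_sq; rewrite /selfadjoint !starM starK sp !cmulA.
have p0 : p = 0 by apply: starM_eq0; rewrite sp pp pg0 scaler0.
by have -> : h = g by apply/esym/subr0_eq; rewrite -pE.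
Qed.

Lemma cpositiveP a : cpositive a <-> spos a.
Proof.
split=> [[y ->]|/spos_sqrt[k [sk _ <- _]]]; first exact: spos_starM.
by exists k; rewrite sk.
Qed.

Lemma spos_add_eq0 h k : spos h -> spos k -> h + k = 0 -> h = 0.
Proof.
move=> hp kp hk; apply: spos_anti => //.
by have -> : - h = k by apply/eqP; rewrite eq_sym -addr_eq0 addrC hk.
Qed.

(** If g <= 1, then k g k <= k^2: with 1 - g = (1 - r)^2 the difference is
    star z z for z = (1 - r) k. *)
Lemma spos_compress g k : selfadjoint g -> rnorm g <= 1 -> selfadjoint k ->
  spos (k ** k - k ** g ** k).
Proof.
move=> sg g1 sk; have [r [sr rr _]] := one_sub_sqrt sg g1.
have -> : k ** k - k ** g ** k = star (k - r ** k) ** (k - r ** k).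
  by rewrite -rr starB starM sr sk !cmulE !cmulA; linear_with R[i].
exact: spos_starM.
Qed.

(** The scale t = 1 / (1 + |h|) serves all positive elements near h, so the bound
    passes to the limit. *)
Lemma spos_closed h :
  (forall e, 0 < e -> exists2 y, spos y & rnorm (y - h) <= e) -> spos h.
Proof.
move=> lim; split.
  apply/subr0_eq; apply: (@rnorm_le_eps _ _ _ 2) => e e0.
  have [y /spos_sa sy ye] := lim _ e0.
  have -> : star h - h = (y - h) - star (y - h).
    by rewrite starB sy; linear_with R[i].
  by apply: le_trans (rnormB _ _) _; rewrite rnorm_star; lra.
have h1 : 0 < 1 + rnorm h by rewrite ltr_pwDl ?rnorm_ge0.
set t := (1 + rnorm h)^-1; have t0 : 0 < t by rewrite invr_gt0.
have t1 : t <= 1 by rewrite invf_le1 // lerDl rnorm_ge0.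
exists t => // x; apply/ler_addgt0Pr => e e0.
have x1 : 0 < 1 + rnorm x by rewrite ltr_pwDl ?rnorm_ge0.
have d0 : 0 < Num.min 1 (e / (1 + rnorm x)) by rewrite lt_min ltr01 divr_gt0.
have [y py] := lim _ d0; rewrite le_min => /andP[y1].
rewrite ler_pdivlMr // => ye.
have cy : compl_contractive (t%:C *: y).
  apply: spos_compl_contractive; first exact: sposZ.
  rewrite rnormZ gtr0_norm // mulrC ler_pdivrMr // mul1r.
  by have := rnormD (y - h) h; rewrite subrK; lra.
have -> : x - (t%:C *: h) ** x =
    (x - (t%:C *: y) ** x) + t%:C *: ((y - h) ** x).
  by rewrite !cmulE; linear_with R[i].
apply: le_trans (rnormD _ _) _; apply: lerD; first exact: cy.
rewrite rnormZ gtr0_norm //.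
have := rnormM (y - h) x; have := rnorm_ge0 (y - h); have := rnorm_ge0 x.
have := rnorm_ge0 ((y - h) ** x); nra.
Qed.

(** The fixed point theorem with the contraction measured by [rnorm]. *)
Lemma contraction_fixpoint (F : A -> A) t : 0 <= t < 1 ->
  (forall x y, rnorm (F x - F y) <= t * rnorm (x - y)) -> exists l, F l = l.
Proof.
move=> /andP[t0 t1] Ft; pose u n := iter n F 0.
pose B := rnorm (F 0) / (1 - t).
have B0 : 0 <= B by rewrite divr_ge0 ?rnorm_ge0 // subr_ge0 ltW.
have uB n : rnorm (u n) <= B.
  elim: n => [|n IH]; first by rewrite rnorm0.
  have -> : u n.+1 = (F (u n) - F 0) + F 0 by rewrite subrK.
  apply: le_trans (rnormD _ _) _; have := Ft (u n) 0; rewrite subr0.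
  have : B * (1 - t) = rnorm (F 0) by rewrite divfK // gt_eqF // subr_gt0.
  nra.
have ud m n : (m <= n)%N -> rnorm (u n - u m) <= B * t ^+ m.
  move=> mn; rewrite -(subnK mn); move: (n - m)%N => d.
  elim: m {mn} => [|m IH]; first by rewrite addn0 subr0 mulr1.
  rewrite addnS; apply: le_trans (Ft _ _) _.
  by rewrite exprS mulrCA ler_wpM2l.
have w0 e : 0 < e -> exists m, B * t ^+ m < e.
  move=> e0; have B1 : 0 < B + 1 by lra.
  have /cvg_expr/cvgrPdist_lt : `|t| < 1 by rewrite ger0_norm.
  move=> /(_ _ (divr_gt0 e0 B1))[m _ /(_ m (leqnn m))] /=.
  rewrite sub0r normrN ger0_norm ?exprn_ge0 // ltr_pdivlMr // => h.
  by exists m; have := exprn_ge0 m t0; nra.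
have [l hl] := complete_rate ud w0; exists l.
apply/subr0_eq; apply: (@rnorm_le_eps _ _ _ 2) => e e0.
have [m hm] := w0 _ e0.
have -> : F l - l = (u m.+1 - l) - (F (u m) - F l).
  by rewrite /u /=; linear_with R[i].
apply: le_trans (rnormB _ _) _.
have := Ft (u m) l; have := hl m; have := hl m.+1; have := rnorm_ge0 (u m - l).
have : B * t ^+ m.+1 <= B * t ^+ m.
  by rewrite ler_wpM2l // exprS ler_piMl ?exprn_ge0 // ltW.
nra.
Qed.

(** The element r = a / (e + a).  With |1 - t a| <= 1, its equation
    (1 + t e) r = (1 - t a) r + t a is a fixed point problem for a contraction of
    ratio 1 / (1 + t e).  Uniqueness of the solution gives the commutation and
    the self-adjointness. *)
Lemma resolvent_exists a e : spos a -> 0 < e ->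
  exists r, [/\ selfadjoint r, e%:C *: r + a ** r = a &
    forall y, a ** y = y ** a -> r ** y = y ** r].
Proof.
move=> [sa [t t0 at1]] e0.
have c0 : 0 < 1 + t * e by rewrite ltr_pwDl // mulr_ge0 ?ltW.
have [r rE] : exists r,
    (1 + t * e)^-1%:C *: (r - (t%:C *: a) ** r + t%:C *: a) = r.
  apply: (@contraction_fixpoint _ (1 + t * e)^-1).
    by rewrite invr_ge0 (ltW c0) invf_lt1 // ltrDl mulr_gt0.
  move=> x y; rewrite -scalerBr rnormZ ger0_norm ?invr_ge0 ?(ltW c0) //.
  rewrite ler_wpM2l ?invr_ge0 ?(ltW c0) //.
  rewrite (_ : _ - _ = (x - y) - (t%:C *: a) ** (x - y)) //.
  by rewrite !cmulE; linear_with R[i].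
have t0' : t%:C != 0 by rewrite fmorph_eq0 gt_eqF.
have ar : e%:C *: r + a ** r = a.
  apply: (scalerI t0').
  have : (1 + t * e)%:C *: r = r - (t%:C *: a) ** r + t%:C *: a.
    by rewrite -{1}rE scalerA -rmorphM divff ?rmorph1 ?scale1r // gt_eqF.
  rewrite !cmulE => /(congr1 (fun v => v - r + t%:C *: (a ** r))) E.
  transitivity ((1 + t * e)%:C *: r - r + t%:C *: (a ** r)).
    by linear_with R[i].
  by rewrite E; linear_with R[i].
have inj y : e%:C *: y + a ** y = 0 -> y = 0.
  move=> ay; apply: contrapT => /rnorm_gt0 y0; have := at1 y.
  have -> : y - (t%:C *: a) ** y =
      (1 + t * e)%:C *: y - t%:C *: (e%:C *: y + a ** y).
    by rewrite !cmulE; linear_with R[i].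
  rewrite ay scaler0 subr0 rnormZ gtr0_norm // mulrDl mul1r gerDl.
  by rewrite leNgt mulr_gt0 // mulr_gt0.
have comm y : a ** y = y ** a -> r ** y = y ** r.
  move=> ay; apply/subr0_eq/inj.
  have -> : e%:C *: (r ** y - y ** r) + a ** (r ** y - y ** r) =
     (e%:C *: r + a ** r) ** y - y ** (e%:C *: r + a ** r).
    by rewrite !cmulE !cmulA ay; linear_with R[i].
  by rewrite ar ay subrr.
exists r; split=> //.
have ra : r ** a = a ** r by exact: comm.
have := congr1 star ar; rewrite starD starZr starM sa => ar'.
apply/subr0_eq/inj.
have -> : e%:C *: (star r - r) + a ** (star r - r) =
   (e%:C *: star r + star r ** a) - (e%:C *: r + a ** r).
  have -> : star r ** a = a ** star r by rewrite -{1}sa -starM -ra starM sa.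
  by rewrite !cmulE; linear_with R[i].
by rewrite ar ar' subrr.
Qed.

End PositiveCone.

(** * Orthogonality of intervals *)

Section Orthogonality.
Context {R : realType} {A : cstarAlgType R}.
Implicit Types (a b c d e g h k x y z u : A) (t : R).

Lemma le_of_pow_le2 (m z : R) : 0 <= m -> 0 <= z ->
  (forall n, z ^+ (2 ^ n) <= 2 * m ^+ (2 ^ n)) -> z <= m.
Proof.
move=> m0 z0 h; rewrite leNgt; apply/negP => mz.
have z1 : 0 < z by exact: le_lt_trans mz.
have q0 : 0 <= m / z by rewrite divr_ge0.
have /cvg_expr/cvgrPdist_lt : `|m / z| < 1.
  by rewrite ger0_norm // ltr_pdivrMr // mul1r.
move=> /(_ 2^-1); rewrite invr_gt0 ltr0n => /(_ isT)[n _ hn].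
have := hn _ (ltnW (ltn_expl n (isT : (1 < 2)%N))); rewrite /= sub0r normrN.
rewrite ger0_norm ?exprn_ge0 // expr_div_n ltr_pdivrMr ?exprn_gt0 //.
by have := h n; lra.
Qed.

(** The power x^(2^n), built by squaring so that the C*-identity applies at each
    step. *)
Fixpoint square_iter x n : A :=
  if n is m.+1 then square_iter x m ** square_iter x m else x.

Lemma square_iter_norm x n : selfadjoint x ->
  selfadjoint (square_iter x n) /\ rnorm (square_iter x n) = rnorm x ^+ (2 ^ n).
Proof.
move=> sx; elim: n => [|n [IH1 IH2]] /=; first by rewrite expr1.
split; first exact: selfadjoint_sq.
by rewrite rnorm_sa_sq // IH2 -exprM expnS mulnC.
Qed.

Lemma square_iterD x y n : x ** y = 0 -> y ** x = 0 ->
  [/\ square_iter (x + y) n = square_iter x n + square_iter y n,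
      square_iter x n ** square_iter y n = 0 &
      square_iter y n ** square_iter x n = 0].
Proof.
move=> xy yx; elim: n => [//|n [IH IHxy IHyx]] /=.
split; first by rewrite IH !cmulE IHxy IHyx addr0 add0r.
- by rewrite cmulA -(cmulA _ (square_iter x n) (square_iter y n)) IHxy !cmulE.
- by rewrite cmulA -(cmulA _ (square_iter y n) (square_iter x n)) IHyx !cmulE.
Qed.

(** From above, |x + y|^N = |x^N + y^N| <= 2 max(|x|, |y|)^N for N = 2^n, and the
    factor 2 disappears in the limit.  From below, x (x + y) = x^2. *)
Lemma rnormD_orth x y : selfadjoint x -> selfadjoint y -> x ** y = 0 ->
  rnorm (x + y) = Num.max (rnorm x) (rnorm y).
Proof.
move=> sx sy xy.
have yx : y ** x = 0 by rewrite -sx -sy -starM xy star0.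
have lower v w : selfadjoint v -> v ** w = 0 -> rnorm v <= rnorm (v + w).
  move=> sv vw; have [->|/eqP/rnorm_gt0 v0] := eqVneq v 0.
    by rewrite rnorm0 rnorm_ge0.
  rewrite -(ler_pM2l v0) -expr2 -rnorm_sa_sq //.
  by have := rnormM v (v + w); rewrite cmulDr vw addr0.
apply/eqP; rewrite eq_le ge_max lower // andTb [x + y in X in _ && X]addrC.
rewrite lower // andbT; apply: le_of_pow_le2; rewrite ?rnorm_ge0 //.
  by rewrite le_max rnorm_ge0.
move=> n; rewrite -(square_iter_norm n (selfadjointD sx sy)).2.
have [-> _ _] := square_iterD n xy yx.
apply: le_trans (rnormD _ _) _; rewrite !(square_iter_norm n _).2 //.
by rewrite mulrDl mul1r lerD // lerXn2r ?nnegrE ?le_max ?rnorm_ge0 ?lexx ?orbT.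
Qed.

(** Compressed by b, the positive elements c and d have sum 0, so b c b = 0. *)
Lemma spos_sum_orth c d b : spos c -> spos d -> selfadjoint b ->
  (c + d) ** b = 0 -> c ** b = 0.
Proof.
move=> /spos_sqrt[u [su _ <- _]] /spos_sqrt[v [sv _ <- _]] sb cdb.
suff ub : u ** b = 0 by rewrite -cmulA ub cmul0r.
apply: starM_eq0; apply: (spos_add_eq0 (spos_starM _) (spos_starM (v ** b))).
by rewrite !starM sb su sv !cmulA -[RHS](cmul0r b) -cdb !cmulE !cmulA.
Qed.

(** Apply [spos_sum_orth] to x + a and a - x, whose sum is 2 a. *)
Lemma interval_orth a b x : a ** b = 0 -> selfadjoint b ->
  sa_interval (- a) a x -> x ** b = 0.
Proof.
move=> ab sb [_ /cpositiveP xa /cpositiveP ax].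
have : (x - - a) ** b = 0.
  by apply: spos_sum_orth xa ax sb _; rewrite !cmulE ab; linear_with R[i].
by rewrite !cmulE ab oppr0 subr0.
Qed.

Lemma ext_oo_orth_of_mul0 a b : spos a -> spos b -> a ** b = 0 ->
  ext_oo_orth a b.
Proof.
move=> [sa _] [sb _] ab x y xa yb k /complex_realP[t ->].
have [sx _ _] := xa; have [sy _ _] := yb.
have xb : x ** b = 0 by exact: interval_orth xa.
have bx : b ** x = 0 by rewrite -sx -sb -starM xb star0.
have yx : y ** x = 0 by exact: interval_orth yb.
have xy : x ** y = 0 by rewrite -sx -sy -starM yx star0.
rewrite !rnormE rnormD_orth //; last by rewrite cmulZr xy scaler0.
  by rewrite /Order.max ltcR; case: ifP.
exact: selfadjointZ.
Qed.

Lemma abs_oo_orth_of_ext a b : spos a -> spos b -> ext_oo_orth a b ->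
  abs_oo_orth a b.
Proof.
have sub c : spos c -> sa_interval 0 c `<=` sa_interval (- c) c.
  move=> cp x [sx /cpositiveP]; rewrite subr0 => xp xc; split=> //.
  by apply/cpositiveP; rewrite opprK; exact: sposD.
by move=> ap bp ab x y xa yb; apply: ab; exact: sub.
Qed.

(** The element e = a / (eps + a), that is, a - a e = eps e.  With k = sqrt a this
    gives (k (1 - e))^2 = eps e (1 - e), so e = e^2 + f^2 for
    f = k (1 - e) / sqrt eps.  Hence e is positive, |e|^2 <= |e|, and
    a - eps e = a e = k (e^2 + f^2) k is positive. *)
Lemma approx_unit_exists a eps : spos a -> 0 < eps ->
  exists e, [/\ spos e, spos (a - eps%:C *: e), rnorm e <= 1,
    eps%:C *: e + a ** e = a &
    forall y, a ** y = y ** a -> e ** y = y ** e].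
Proof.
move=> ap eps0; have [e [se ae ec]] := resolvent_exists ap eps0.
have [k [sk _ kk kc]] := spos_sqrt ap.
have ke : e ** k = k ** e by apply: ec; rewrite -kk cmulA.
have s0 : 0 < Num.sqrt eps by rewrite sqrtr_gt0.
have ss : (Num.sqrt eps)^-1 * (Num.sqrt eps)^-1 = eps^-1.
  by rewrite -invfM -expr2 sqr_sqrtr // ltW.
pose f := (Num.sqrt eps)^-1%:C *: (k - k ** e).
have sf : selfadjoint f.
  by apply: selfadjointZ; rewrite /selfadjoint starB starM se sk ke.
have eae : a - a ** e = eps%:C *: e by rewrite -{1}ae addrK.
have eE : e = e ** e + f ** f.
  have e0 : eps%:C != 0 by rewrite fmorph_eq0 gt_eqF.
  rewrite /f cmulZl cmulZr scalerA -rmorphM /= ss.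
  have -> : (k - k ** e) ** (k - k ** e) = (a - a ** e) - (a - a ** e) ** e.
    rewrite -kk !cmulE !cmulA -(cmulA k e k) ke !cmulA.
    by linear_with R[i].
  rewrite eae cmulZl -scalerBr scalerA -rmorphM /= mulVf ?gt_eqF //.
  by rewrite rmorph1 scale1r addrC subrK.
have ef : e ** f = f ** e.
  by rewrite /f !cmulE !cmulA ke.
exists e; split=> //.
- by rewrite eE; apply: sposD; exact: spos_sq.
- have -> : a - eps%:C *: e =
      star (e ** k) ** (e ** k) + star (f ** k) ** (f ** k).
    rewrite !starM se sf sk !cmulA.
    rewrite -(cmulA k e e) -(cmulA k f f) -cmulDl -cmulDr -eE -ke -cmulA kk.
    by rewrite ec // -{1}ae addrC addKr.
  by apply: sposD; exact: spos_starM.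
- have [->|/eqP/rnorm_gt0 e0] := eqVneq e 0; first by rewrite rnorm0.
  have := @rnorm_sq_le_add_starM _ _ e f; rewrite se sf -eE => /(_ ef).
  by rewrite expr2 ger_pMl.
Qed.

(** With e as in [approx_unit_exists] and t = |e| / |b|, the hypothesis for eps e
    and b reads |e + t b| = |e| <= 1, and compressing by k = sqrt a gives
    t k b k <= eps e.  As t is bounded below, - k b k is a limit of positive
    elements. *)
Lemma mul0_of_abs_oo_orth a b : spos a -> spos b -> abs_oo_orth a b ->
  a ** b = 0.
Proof.
move=> ap bp ab.
have [->|/eqP/rnorm_gt0 a0] := eqVneq a 0; first by rewrite cmul0l.
have [->|/eqP/rnorm_gt0 b0] := eqVneq b 0; first by rewrite cmul0r.
have [k [sk _ kk kc]] := spos_sqrt ap.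
have [l [sl _ ll _]] := spos_sqrt bp.
have kbkE : k ** b ** k = star (l ** k) ** (l ** k).
  by rewrite starM sl sk !cmulA -(cmulA k l l) ll.
suff kbk0 : spos (- (k ** b ** k)).
  have lk : l ** k = 0.
    apply: starM_eq0; rewrite -kbkE; apply: spos_anti => //.
    by rewrite kbkE; exact: spos_starM.
  have kl : k ** l = 0 by rewrite -sk -sl -starM lk star0.
  by rewrite -kk -ll cmulA -(cmulA k k l) kl !cmulE.
apply: spos_closed => d d0.
(* The second bound makes (eps / t) |e| = eps |b| at most d; the first one keeps
   e, and with it t, away from 0. *)
pose eps := Num.min (rnorm a) (d / (2 * rnorm b)).
have eps0 : 0 < eps by rewrite lt_min a0 divr_gt0 // mulr_gt0.
have [epsa epsd] : eps <= rnorm a /\ eps <= d / (2 * rnorm b).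
  by split; rewrite ge_min lexx ?orbT.
have [e [ep eap e1 ae ec]] := approx_unit_exists ap eps0.
have ehalf : 2^-1 <= rnorm e.
  have := rnormD (eps%:C *: e) (a ** e); rewrite ae rnormZ gtr0_norm //.
  have := rnormM a e; have := rnorm_ge0 e; nra.
have e0 : 0 < rnorm e by lra.
pose t := rnorm e / rnorm b.
have t0 : 0 < t by rewrite divr_gt0.
have n1 : rnorm (e + t%:C *: b) <= 1.
  have xa : sa_interval 0 a (eps%:C *: e).
    split; [exact/selfadjointZ/spos_sa| |exact/cpositiveP].
    by apply/cpositiveP; rewrite subr0; exact: sposZ.
  have yb : sa_interval 0 b b.
    split; [exact: spos_sa|by apply/cpositiveP; rewrite subr0|].
    by exists 0; rewrite subrr cmul0r.
  have := ab _ _ xa yb (eps * t)%:C.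
  rewrite complex_real eqxx => /(_ isT).
  have -> : eps%:C *: e + (eps * t)%:C *: b = eps%:C *: (e + t%:C *: b).
    by linear_with R[i].
  have tb : t * rnorm b = rnorm e by rewrite divfK // gt_eqF.
  rewrite !rnormE !rnormZ normrM !gtr0_norm // -mulrA tb maxxx => /complexI.
  by move/(mulfI (lt0r_neq0 eps0)) => ->.
have ke : e ** k = k ** e by apply: ec; rewrite -kk cmulA.
have seb := selfadjointD (spos_sa ep) (selfadjointZ t (spos_sa bp)).
have := spos_compress seb n1 sk.
have -> : k ** k - k ** (e + t%:C *: b) ** k =
    eps%:C *: e - t%:C *: (k ** b ** k).
  rewrite !cmulE -(cmulA k e k) ke cmulA kk -{1}ae.
  by linear_with R[i].
have ti : 0 < t^-1 by rewrite invr_gt0.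
move=> /(sposZ ti) sp.
exists ((eps / t)%:C *: e - k ** b ** k).
  have -> : (eps / t)%:C *: e - k ** b ** k =
      t^-1%:C *: (eps%:C *: e - t%:C *: (k ** b ** k)) => //.
  rewrite scalerBr !scalerA -!rmorphM /= mulVf ?gt_eqF // rmorph1 scale1r.
  by rewrite mulrC.
rewrite opprK subrK rnormZ gtr0_norm ?divr_gt0 //.
have -> : eps / t * rnorm e = eps * rnorm b.
  by rewrite /t; field; rewrite !gt_eqF //; lra.
move: epsd; rewrite ler_pdivlMr ?mulr_gt0 // => epsd.
by have := mulr_gt0 eps0 b0; lra.
Qed.

End Orthogonality.

Theorem corollary3p3 (R : realType) (A : cstarAlgType R) (a b : A)
  (ha : cpositive a) (hb : cpositive b) :
  (ext_oo_orth a b <-> abs_oo_orth a b) /\ (abs_oo_orth a b <-> a ** b = 0).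
Proof.
move: ha hb => /cpositiveP ap /cpositiveP bp.
have e2a := abs_oo_orth_of_ext ap bp.
have a2m := mul0_of_abs_oo_orth ap bp.
have m2e := ext_oo_orth_of_mul0 ap bp.
by split; split=> // h; [exact/m2e/a2m | exact/e2a/m2e].
Qed.
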